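(* Let $\mathcal{P}$ be a PTRS that is orthogonal and right-linear (equivalently, non-overlapping and linear). Then $\mathrm{edc}_{\xrightarrow{\mathbf{f}}_{\mathcal{P}}}=\mathrm{edc}_{\xrightarrow{\mathbf{i}}_{\mathcal{P}}}$ and $\mathrm{erc}_{\xrightarrow{\mathbf{f}}_{\mathcal{P}}}=\mathrm{erc}_{\xrightarrow{\mathbf{i}}_{\mathcal{P}}}$ (as functions $\mathbb{N}\to\mathbb{N}\cup\{\omega\}$).
   Context: Terms $\mathcal{T}$ over a countable signature $\Sigma$ and countable variables $\mathcal{V}$. A finite multi-distribution on $A\ne\emptyset$: finite multiset of pairs $(p:a)$, $0<p\le1$, probabilities summing to 1; $\mathrm{FDist}(A)$, $\mathrm{Supp}(\mu)$, $p\cdot\mu$ as usual. A PTRS is a countable set $\mathcal{P}$ of rules $\ell\to\mu$, $\ell\notin\mathcal{V}$, $\mu\in\mathrm{FDist}(\mathcal{T})$, $\mathcal{V}(r)\subseteq\mathcal{V}(\ell)$ for $r\in\mathrm{Supp}(\mu)$. $s\xrightarrow{\mathbf{f}}_{\mathcal{P}}\{p_1:t_1,\dots,p_k:t_k\}$ iff $s|_\pi=\ell\sigma$ and $t_j=s[r_j\sigma]_\pi$ for some position $\pi$, rule $\ell\to\{p_1:r_1,\dots,p_k:r_k\}\in\mathcal{P}$, substitution $\sigma$; innermost ($\xrightarrow{\mathbf{i}}_{\mathcal{P}}$) if all proper subterms of $\ell\sigma$ are normal forms (terms admitting no step). Lifting $\rightrightarrows$ of $\to$: smallest relation on $\mathrm{FDist}(\mathcal{T})$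 with $\{1:t\}\rightrightarrows\{1:t\}$ for normal forms, $\{1:t\}\rightrightarrows\mu$ if $t\to\mu$, and $\bigcup_jp_j\cdot\mu_j\rightrightarrows\bigcup_jp_j\cdot\nu_j$ if $\mu_j\rightrightarrows\nu_j$, $\sum p_j=1$. $|\mu|_\to$: total probability of normal forms in $\mu$. $\mathrm{edl}((\mu_n))=\sum_{n\ge0}(1-|\mu_n|_\to)$; $\mathrm{edh}_\to(t)=\sup\{\mathrm{edl}(\vec\mu)\mid\vec\mu$ infinite $\rightrightarrows$-sequence, $\mu_0=\{1:t\}\}$. Term size: $|x|=1$, $|f(t_1,\dots,t_k)|=1+\sum|t_i|$. Expected derivational complexity: $\mathrm{edc}_\to(n)=\sup\{\mathrm{edh}_\to(t)\mid t\in\mathcal{T},|t|\le n\}$. Defined symbols of $\mathcal{P}$ are root symbols of left-hand sides; all other symbols are constructors; a term is basic if it is $f(t_1,\dots,t_k)$ with $f$ defined and each $t_i$ built only from constructors and variables. Expected runtime complexity: $\mathrm{erc}_\to(n)=\sup\{\mathrm{edh}_\to(t)\mid t$ basic$,|t|\le n\}$ (with $\sup\emptyset=0$). Non-overlapping: no two rules (renamed apart) and non-variable position $\pi$ of the first left-hand side $\ell_1$ with $\ell_1|_\pi$ unifiable with the second left-hand side ($\pi\ne\varepsilon$ if the same rule). Left-/right-linear: no variable occurs twice in a left-hand side / in any $r\in\mathrm{Supp}(\mu)$. Orthogonal: non-overlapping and left-linear. *)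

(* Defs.v *)
From HB Require Import structures.
From mathcomp Require Import all_boot all_order all_algebra.
From mathcomp Require Import finmap multiset.
From mathcomp Require Import all_classical all_reals all_analysis.

Set Implicit Arguments.
Unset Strict Implicit.
Unset Printing Implicit Defensive.

Import Order.TTheory GRing.Theory Num.Theory.

Local Open Scope classical_set_scope.
Local Open Scope ring_scope.

Section FDist.
Variables (R : realType) (A : choiceType).

Definition is_fdist (mu : {mset (R * A)}%mset) : bool :=
  all (fun x : R * A => 0 < x.1 <= 1) mu && (\sum_(x <- mu) x.1 == 1).

Record fdist := FDist { fdist_mset :> {mset (R * A)}%mset ; _ : is_fdist fdist_mset }.

Definition fdist_supp (mu : fdist) : set A := [set a | exists p : R, (p, a) \in (mu : seq _)].

Lemma dirac_is_fdist (a : A) : is_fdist [mset (1 : R, a)]%mset.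
Proof. by rewrite /is_fdist enum_msetn /= big_seq1 ltr01 lexx eqxx. Qed.

Definition fdirac (a : A) : fdist := FDist (dirac_is_fdist a).

Definition mset_scale (p : R) (mu : {mset (R * A)}%mset) : {mset (R * A)}%mset :=
  seq_mset [seq (p * x.1, x.2) | x <- mu].

(* The union of multi-distributions adds multiplicities: it is msetD, whereas
   msetU takes the maximum of the multiplicities. *)
Definition mset_mix (k : nat) (p : 'I_k -> R) (mu : 'I_k -> fdist) : {mset (R * A)}%mset :=
  \big[(@msetD _)/(@mset0 _)]_(j < k) mset_scale (p j) (mu j).

End FDist.

Definition mset_map (R : realType) (A B : choiceType) (f : A -> B)
    (mu : {mset (R * A)}%mset) : {mset (R * B)}%mset :=
  seq_mset [seq (x.1, f x.2) | x <- mu].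

Section ExpectedDerivation.
Variables (R : realType) (A : choiceType) (step : A -> fdist R A -> Prop).

Definition normal_form (t : A) : Prop := ~ exists mu, step t mu.

Inductive lifting : fdist R A -> fdist R A -> Prop :=
| lifting_nf (t : A) : normal_form t -> lifting (fdirac R t) (fdirac R t)
| lifting_step (t : A) (mu : fdist R A) : step t mu -> lifting (fdirac R t) mu
| lifting_mix (k : nat) (p : 'I_k -> R) (mu nu : 'I_k -> fdist R A) (mu' nu' : fdist R A) :
    (forall j, 0 < p j) -> \sum_(j < k) p j = 1 ->
    (forall j, lifting (mu j) (nu j)) ->
    fdist_mset mu' = mset_mix p mu -> fdist_mset nu' = mset_mix p nu ->
    lifting mu' nu'.

Definition nf_prob (mu : fdist R A) : R :=
  \sum_(x <- (mu : seq _) | `[< normal_form x.2 >]) x.1.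

Definition edl (mu : nat -> fdist R A) : \bar R :=
  (\sum_(0 <= n <oo) (1 - nf_prob (mu n))%:E)%E.

(* Supremum in [0, +oo]; in particular the supremum of the empty set is 0,
   unlike ereal_sup set0 = -oo. *)
Definition sup_nneg (X : set (\bar R)) : \bar R := ereal_sup (0%E |` X).

Definition edh (t : A) : \bar R :=
  sup_nneg [set edl mu | mu in
    [set mu : nat -> fdist R A | mu 0%N = fdirac R t /\ forall n, lifting (mu n) (mu n.+1)]].

End ExpectedDerivation.

Record signature := Signature { sym :> countType ; arity : sym -> nat }.

Inductive term (S : signature) (V : Type) : Type :=
| Var (x : V)
| App (f : S) (args : 'I_(arity f) -> term S V).

Arguments Var {S V} x.
Arguments App {S V} f args.

HB.instance Definition _ (S : signature) (V : Type) := gen_eqMixin (term S V).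
HB.instance Definition _ (S : signature) (V : Type) := gen_choiceMixin (term S V).

Section Terms.
Variables (S : signature) (V : Type).

Fixpoint term_size (t : term S V) : nat :=
  match t with
  | Var _ => 1
  | App f args => (1 + \sum_(i < arity f) term_size (args i))%N
  end.

Definition is_var (t : term S V) : bool := if t is Var _ then true else false.

(* Positions are sequences of argument indices, counted from 0. *)
Fixpoint subterm_at (t : term S V) (pi : seq nat) : option (term S V) :=
  match pi, t with
  | [::], _ => Some t
  | i :: pi', App f args =>
      if insub i is Some j then subterm_at (args j) pi' else None
  | _ :: _, Var _ => None
  end.

Fixpoint replace_at (t : term S V) (pi : seq nat) (u : term S V) : term S V :=
  match pi, t with
  | [::], _ => u
  | i :: pi', App f args =>
      App f (fun j => if (j : nat) == i then replace_at (args j) pi' u else args j)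
  | _ :: _, Var _ => t
  end.

Definition proper_subterm (u t : term S V) : Prop :=
  exists2 pi : seq nat, pi <> [::] & subterm_at t pi = Some u.

End Terms.

Section Substitution.
Variables (S : signature) (V W : Type).

Fixpoint subst (s : V -> term S W) (t : term S V) : term S W :=
  match t with
  | Var x => s x
  | App f args => App f (fun i => subst s (args i))
  end.

Definition rename (h : V -> W) : term S V -> term S W :=
  subst (fun x => Var (h x)).

End Substitution.

Definition unifiable (S : signature) (V : Type) (s t : term S V) : Prop :=
  exists sigma : V -> term S V, subst sigma s = subst sigma t.

Section Occurrences.
Variables (S : signature) (V : eqType).

Fixpoint nocc (x : V) (t : term S V) : nat :=
  match t with
  | Var y => (x == y)
  | App f args => (\sum_(i < arity f) nocc x (args i))%N
  end.

Definition vars (t : term S V) : set V := [set x | (0 < nocc x t)%N].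

Definition linear_term (t : term S V) : Prop :=
  forall x : V, (nocc x t <= 1)%N.

End Occurrences.

Section PTRS.
Variables (R : realType) (S : signature) (V : countType).

Record rule := Rule { lhs : term S V ; rhs : fdist R (term S V) }.

Record ptrs := Ptrs {
  rules : set rule ;
  rules_countable : countable rules ;
  rules_lhs : forall r, rules r -> ~~ is_var (lhs r) ;
  rules_vars : forall r, rules r ->
    forall t, fdist_supp (rhs r) t -> vars t `<=` vars (lhs r) }.

Variable P : ptrs.

Definition contracts (s : term S V) (pi : seq nat) (r : rule) (sigma : V -> term S V)
    (mu : fdist R (term S V)) : Prop :=
  subterm_at s pi = Some (subst sigma (lhs r)) /\
  fdist_mset mu = mset_map (fun t => replace_at s pi (subst sigma t)) (rhs r).

Definition full_step (s : term S V) (mu : fdist R (term S V)) : Prop :=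
  exists pi r sigma, rules P r /\ contracts s pi r sigma mu.

Definition innermost_step (s : term S V) (mu : fdist R (term S V)) : Prop :=
  exists pi r sigma, [/\ rules P r, contracts s pi r sigma mu &
    forall u, proper_subterm u (subst sigma (lhs r)) -> normal_form full_step u].

(* The two rules are renamed apart by moving their variables to the two
   summands of V + V. *)
Definition overlap (r1 r2 : rule) (pi : seq nat) : Prop :=
  exists u : term S V,
    [/\ subterm_at (lhs r1) pi = Some u, ~~ is_var u,
        r1 = r2 -> pi <> [::] &
        unifiable (rename (inl : V -> V + V) u) (rename (inr : V -> V + V) (lhs r2))].

Definition non_overlapping : Prop :=
  forall r1 r2 pi, rules P r1 -> rules P r2 -> ~ overlap r1 r2 pi.

Definition left_linear : Prop := forall r, rules P r -> linear_term (lhs r).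

Definition right_linear : Prop :=
  forall r, rules P r -> forall t, fdist_supp (rhs r) t -> linear_term t.

Definition orthogonal_ptrs : Prop := non_overlapping /\ left_linear.

Definition defined_symbol (f : S) : Prop :=
  exists r, rules P r /\ exists args, lhs r = App f args.

Fixpoint constructor_term (t : term S V) : Prop :=
  match t with
  | Var _ => True
  | App f args => ~ defined_symbol f /\ forall i, constructor_term (args i)
  end.

Definition basic (t : term S V) : Prop :=
  match t with
  | Var _ => False
  | App f args => defined_symbol f /\ forall i, constructor_term (args i)
  end.

End PTRS.

Section Complexity.
Variables (R : realType) (S : signature) (V : countType).

Definition edc (step : term S V -> fdist R (term S V) -> Prop) (n : nat) : \bar R :=
  sup_nneg [set edh step t | t in [set t : term S V | (term_size t <= n)%N]].

Definition erc (P : ptrs R S V) (step : term S V -> fdist R (term S V) -> Prop) (n : nat) :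
    \bar R :=
  sup_nneg [set edh step t | t in [set t : term S V | basic P t /\ (term_size t <= n)%N]].

End Complexity.

(* Main.v *)
Require Import Defs.
From mathcomp Require Import all_boot all_order all_algebra.
From mathcomp Require Import finmap multiset.
From mathcomp Require Import all_classical all_reals all_analysis.
From mathcomp Require Import lra.

(** Full and innermost steps have the same normal forms, so only the bound of
    full derivations by innermost ones is at stake. Let [W n u] be the greatest
    expected number of steps within the first [n] rounds of a full strategy
    started in [u]. An innermost redex of [u] is equal to, parallel to, or inside
    the substitution of any other redex; by orthogonality and right-linearity
    contracting the latter leaves at most one copy of the former. Hence an
    innermost step [u -> {q_k : u_k}] satisfies
      [W n u <= 1 + \sum_k q_k * W n u_k].
    Iterating this along any innermost derivation [nu] gives, for every [N],
      [W n u <= (expected steps of nu before N) + n * P(nu is alive at N)],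
    and if [nu] has finite expected length, its survival probability cannot stay
    away from 0, so that [W n u] is at most that length. *)

Set Implicit Arguments.
Unset Strict Implicit.
Unset Printing Implicit Defensive.

Import Order.TTheory GRing.Theory Num.Theory.

Local Open Scope classical_set_scope.
Local Open Scope ring_scope.

(** * Expectations of finite multi-distributions *)

Section Expectation.
Variables (R : realType) (A : choiceType).
Implicit Types (m : {mset (R * A)}%mset) (mu : fdist R A) (F G : A -> R).

(** Taken over arbitrary multisets, so that it applies to a scaled or mixed multiset before this is
    known to be a distribution. *)
Definition expect m F : R := \sum_(x <- (m : seq _)) x.1 * F x.2.

Lemma fdist_inj mu nu : fdist_mset mu = fdist_mset nu -> mu = nu.
Proof.
case: mu nu => [m hm] [m' hm'] /= e; case: _ / e hm' => hm'.
by rewrite (bool_irrelevance hm hm').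
Qed.

Lemma fdist_prob_gt0 mu x : x \in (mu : seq _) -> 0 < x.1.
Proof. by case: mu => m /= /andP[/allP h _] /h /andP[]. Qed.

Lemma expect_seq (s : seq (R * A)) F :
  expect (seq_mset s) F = \sum_(x <- s) x.1 * F x.2.
Proof. exact: perm_big (perm_eq_seq_mset s). Qed.

Lemma big_msetD (T : choiceType) (m m' : {mset T}%mset) (F : T -> R) :
  \sum_(x <- (m `+` m')%mset) F x = \sum_(x <- m) F x + \sum_(x <- m') F x.
Proof.
rewrite -big_cat; apply: perm_big; apply/allP => x _ /=.
by rewrite count_cat !count_mem_mset msetE2.
Qed.

Lemma expectD m m' F : expect (m `+` m')%mset F = expect m F + expect m' F.
Proof. exact: big_msetD. Qed.

Lemma expect_scale p m F : expect (mset_scale p m) F = p * expect m F.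
Proof.
rewrite expect_seq big_map big_distrr /=.
by apply: eq_bigr => x _; rewrite mulrA.
Qed.

Lemma expect_mix k (p : 'I_k -> R) (mu : 'I_k -> fdist R A) F :
  expect (mset_mix p mu) F = \sum_(j < k) p j * expect (mu j) F.
Proof.
rewrite /mset_mix; elim/big_rec2: _ => [|j x m _ <-].
  by rewrite /expect enum_mset0 big_nil.
by rewrite expectD expect_scale.
Qed.

Lemma expect_dirac a F : expect (fdirac R a) F = F a.
Proof. by rewrite /expect /= enum_msetn big_seq1 mul1r. Qed.

Lemma expect_cst mu c : expect mu (fun=> c) = c.
Proof.
rewrite /expect -big_distrl /=.
by case: mu => m /= /andP[_ /eqP ->]; rewrite mul1r.
Qed.

Lemma expect_addF m F G :
  expect m (fun a => F a + G a) = expect m F + expect m G.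
Proof. by rewrite /expect -big_split; apply: eq_bigr => x _; rewrite mulrDr. Qed.

Lemma expect_scaleF m c F : expect m (fun a => c * F a) = c * expect m F.
Proof.
by rewrite /expect big_distrr; apply: eq_bigr => x _ /=; rewrite mulrCA.
Qed.

Lemma le_expect mu F G :
  (forall a, fdist_supp mu a -> F a <= G a) -> expect mu F <= expect mu G.
Proof.
move=> h; rewrite /expect !big_seq; apply: ler_sum => x xmu.
apply: ler_wpM2l; first exact/ltW/(fdist_prob_gt0 xmu).
by apply: h; exists x.1; rewrite -surjective_pairing.
Qed.

Lemma expect_ge0 mu F : (forall a, 0 <= F a) -> 0 <= expect mu F.
Proof. by move=> h; rewrite -(expect_cst mu 0); apply: le_expect. Qed.

Lemma is_fdist_mix k (p : 'I_k -> R) (mu : 'I_k -> fdist R A) :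
  (forall j, 0 < p j) -> \sum_(j < k) p j = 1 -> is_fdist (mset_mix p mu).
Proof.
move=> p0 p1; apply/andP; split; last first.
  (* The total mass is the expectation of the constant 1. *)
  have := expect_mix p mu (fun=> 1).
  under [RHS]eq_bigr do rewrite expect_cst mulr1.
  by rewrite p1 /expect => /eqP; under eq_bigr do rewrite mulr1.
have pmix x : x \in (mset_mix p mu : seq _) ->
    exists j, x \in (mset_scale (p j) (mu j) : seq _).
  rewrite /mset_mix; elim/big_rec: _ => [|j m _ IH]; first by rewrite enum_mset0.
  rewrite -[x \in _]/(x \in (_ `+` _)%mset) in_msetD => /orP[xj|/IH //].
  by exists j.
apply/allP => x /pmix[j]; rewrite (perm_mem (perm_eq_seq_mset _)).
move=> /mapP[y ymu ->] /=.
have y0 := fdist_prob_gt0 ymu; rewrite mulr_gt0 //=.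
have y1 : y.1 <= 1.
  by case: (mu j) ymu => m /= /andP[/allP h _] /h /andP[].
have pj : p j <= 1.
  rewrite -p1 (bigD1 j) //= lerDl; apply: sumr_ge0 => i _; exact: ltW.
by apply: mulr_ile1 => //; exact: ltW.
Qed.

(** Puts a distribution into the form demanded by [lifting_mix], so that its points can be rewritten
    independently. *)
Lemma fdist_mix_dirac mu (a0 : R * A) :
  fdist_mset mu = mset_mix (fun j : 'I_(size mu) => (nth a0 mu j).1)
                           (fun j => fdirac R (nth a0 mu j).2).
Proof.
rewrite -[LHS]seq_mset_id -[X in seq_mset X](mkseq_nth a0) /mset_mix.
have -> : mkseq (nth a0 mu) (size mu) =
    [seq nth a0 mu (i : nat) | i : 'I_(size mu) <- index_enum 'I_(size mu)].
  by rewrite /mkseq -val_enum_ord -map_comp /index_enum -enumT.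
elim: (index_enum _) => [|i s IH] /=.
  by rewrite big_nil; apply/msetP => x; rewrite mset_seqE mset0E.
rewrite big_cons -IH mset_cons; congr (_ `+` _)%mset.
apply/msetP => x; rewrite /mset_scale /= enum_msetn /= mset_seqE /= mulr1.
by rewrite -surjective_pairing msetnE addn0 eq_sym; case: eqP.
Qed.

End Expectation.

Lemma expect_map (R : realType) (A B : choiceType) (f : A -> B)
    (m : {mset (R * A)}%mset) (F : B -> R) :
  expect (mset_map f m) F = expect m (F \o f).
Proof. by rewrite expect_seq big_map. Qed.

Lemma is_fdist_map (R : realType) (A B : choiceType) (f : A -> B)
    (mu : fdist R A) : is_fdist (mset_map f mu).
Proof.
apply/andP; split.
  apply/allP => x; rewrite (perm_mem (perm_eq_seq_mset _)) => /mapP[y ymu ->] /=.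
  by case: mu ymu => m /= /andP[/allP h _] /h.
have := expect_map f mu (fun=> 1).
rewrite expect_cst /expect => /eqP; by under eq_bigr do rewrite mulr1.
Qed.

Lemma expect_exchange (R : realType) (A B : choiceType)
    (m : {mset (R * A)}%mset) (m' : {mset (R * B)}%mset) (F : A -> B -> R) :
  expect m (fun a => expect m' (F a)) =
  expect m' (fun b => expect m (F^~ b)).
Proof.
rewrite /expect; under eq_bigr do rewrite big_distrr /=.
under [RHS]eq_bigr do rewrite big_distrr /=.
rewrite exchange_big; apply: eq_bigr => y _; apply: eq_bigr => x _.
by rewrite mulrCA.
Qed.

(** * Lifting and derivation lengths *)

Section Derivations.
Variables (R : realType) (A : choiceType) (step : A -> fdist R A -> Prop).
Implicit Types (mu nu : fdist R A).

Definition reducible (a : A) : R := (~~ `[< normal_form step a >])%:R.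

Lemma reducible_ge0 a : 0 <= reducible a.
Proof. exact: ler0n. Qed.

Lemma reducible_nf a : normal_form step a -> reducible a = 0.
Proof. by move=> h; rewrite /reducible asboolT. Qed.

Lemma reducible_step a mu : step a mu -> reducible a = 1.
Proof. by move=> h; rewrite /reducible asboolF // => n; apply: n; exists mu. Qed.

Lemma nf_probE mu : 1 - nf_prob step mu = expect mu reducible.
Proof.
apply/eqP; rewrite subr_eq -[X in X == _](expect_cst mu 1); apply/eqP.
rewrite /nf_prob /expect [X in _ + X]big_mkcond -big_split; apply: eq_bigr => x _ /=.
by rewrite /reducible; case: ifP; rewrite ?(mulr0, mulr1, add0r, addr0).
Qed.

(** Normal forms stay put and every other point has a step, so one successor per point can be chosen
    and mixed. Hence infinite sequences exist from any start. *)
Lemma lifting_exists mu : exists nu, lifting step mu nu.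
Proof.
have one a : exists nu, lifting step (fdirac R a) nu.
  have [nf|/contrapT[nu s]] := pselect (normal_form step a).
    by exists (fdirac R a); exact: lifting_nf.
  by exists nu; exact: lifting_step.
have [nxt nxtP] := choice one.
(* Total mass 1 excludes the empty multiset; any entry serves as default for [nth]. *)
have [a0 _] : exists a0 : R * A, True.
  case: mu => m /= /andP[_]; case: (m : seq _) => [|a s]; last by exists a.
  by rewrite big_nil eq_sym oner_eq0.
have p0 (j : 'I_(size mu)) : 0 < (nth a0 mu j).1.
  by apply: (@fdist_prob_gt0 _ _ mu); rewrite mem_nth.
have p1 : \sum_(j < size mu) (nth a0 mu j).1 = 1.
  rewrite -(big_mkord xpredT (fun j => (nth a0 mu j).1)) -(big_nth a0 xpredT fst).
  by case: (mu) => m /= /andP[_ /eqP].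
exists (FDist (is_fdist_mix (fun j => nxt (nth a0 mu j).2) p0 p1)).
apply: (lifting_mix p0 p1 (fun j => nxtP (nth a0 mu j).2)) => //.
exact: fdist_mix_dirac.
Qed.

Lemma lifting_sequence a : exists mu : nat -> fdist R A,
  mu 0%N = fdirac R a /\ forall n, lifting step (mu n) (mu n.+1).
Proof.
have [nxt nxtP] := choice lifting_exists.
by exists (fun n => iter n nxt (fdirac R a)); split => // n; exact: nxtP.
Qed.

(** Both sides are linear in mixtures, so only point masses need checking. Allowing [G] to differ
    from [F] lets it account for the cost of the step. *)
Lemma lifting_expect_le (F G : A -> R) mu nu :
  (forall a, normal_form step a -> F a <= G a) ->
  (forall a rho, step a rho -> expect rho F <= G a) ->
  lifting step mu nu -> expect nu F <= expect mu G.
Proof.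
move=> nfFG stFG; elim=> {mu nu} [a nf|a rho s|k p mu nu mu' nu' p0 _ _ IH -> ->].
- by rewrite !expect_dirac; exact: nfFG.
- by rewrite expect_dirac; exact: stFG.
- by rewrite !expect_mix; apply: ler_sum => j _; rewrite ler_pM2l.
Qed.

(** * Partial sums of derivation lengths and optimal truncated strategies *)

Lemma edl_term_ge0 (mu : nat -> fdist R A) n :
  (0 <= (1 - nf_prob step (mu n))%:E)%E.
Proof. by rewrite lee_fin nf_probE expect_ge0 // => a; exact: reducible_ge0. Qed.

Definition steps_upto (mu : nat -> fdist R A) n : R :=
  \sum_(0 <= i < n) (1 - nf_prob step (mu i)).

Lemma steps_upto_le_edl (mu : nat -> fdist R A) n :
  ((steps_upto mu n)%:E <= edl step mu)%E.
Proof.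
rewrite /steps_upto -sumEFin; apply: nneseries_lim_ge => i _ _.
exact: edl_term_ge0.
Qed.

Lemma edl_le (mu : nat -> fdist R A) (x : \bar R) :
  (forall n, ((steps_upto mu n)%:E <= x)%E) -> (edl step mu <= x)%E.
Proof.
move=> h; apply: lime_le.
  by apply: is_cvg_nneseries => n _ _; exact: edl_term_ge0.
by apply: nearW => n; rewrite sumEFin; exact: h.
Qed.

(* The greatest expected number of steps among the first [n] steps of a
   strategy started in [a]. *)
Fixpoint max_steps (n : nat) (a : A) : R :=
  if n is n'.+1 then
    sup (0 |` [set 1 + expect mu (max_steps n') | mu in step a])
  else 0.

(** The bound [n] also makes the real [sup] in [max_steps] a genuine least upper bound. *)
Lemma max_steps_bounds n a : 0 <= max_steps n a <= n%:R.
Proof.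
elim: n a => [|n IH] a /=; first by rewrite lexx.
have ub : ubound (0 |` [set 1 + expect mu (max_steps n) | mu in step a]) n.+1%:R.
  move=> _ [->|[mu _ <-]] //; rewrite -natr1 addrC lerD2r -(expect_cst mu n%:R).
  by apply: le_expect => b _; have /andP[] := IH b.
apply/andP; split; last by apply: ge_sup => //; exists 0; left.
by apply: ub_le_sup; [exists n.+1%:R|left].
Qed.

Lemma max_steps_ge0 n a : 0 <= max_steps n a.
Proof. by have /andP[] := max_steps_bounds n a. Qed.

Lemma max_steps_ge n a mu : step a mu ->
  1 + expect mu (max_steps n) <= max_steps n.+1 a.
Proof.
move=> s; apply: ub_le_sup; last by right; exists mu.
exists n.+1%:R => _ [->|[nu _ <-]] //; rewrite -natr1 addrC lerD2r.
rewrite -(expect_cst nu n%:R); apply: le_expect => b _.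
by have /andP[] := max_steps_bounds n b.
Qed.

Lemma max_stepsS_le n a x : 0 <= x ->
  (forall mu, step a mu -> 1 + expect mu (max_steps n) <= x) ->
  max_steps n.+1 a <= x.
Proof.
move=> x0 h; apply: ge_sup; first by exists 0; left.
by move=> _ [->|[mu s <-]] //; exact: h.
Qed.

Lemma max_steps_mono n a : max_steps n a <= max_steps n.+1 a.
Proof.
elim: n a => [|n IH] a; first exact: max_steps_ge0.
apply: max_stepsS_le => [|mu s]; first exact: max_steps_ge0.
apply: le_trans (max_steps_ge n.+1 s).
by rewrite lerD2l; apply: le_expect => b _; exact: IH.
Qed.

Lemma max_steps_nf n a : normal_form step a -> max_steps n a = 0.
Proof.
move=> nf; apply/eqP; rewrite eq_le max_steps_ge0 andbT.
case: n => [//|n]; apply: max_stepsS_le => // mu s.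
by case: nf; exists mu.
Qed.

(** In expectation, this bounds what is left to gain by [n] times the survival probability. *)
Lemma max_steps_le_reducible n a : max_steps n a <= n%:R * reducible a.
Proof.
have [nf|/contrapT[mu s]] := pselect (normal_form step a).
  by rewrite max_steps_nf // mulr_ge0 // reducible_ge0.
by rewrite (reducible_step s) mulr1; have /andP[] := max_steps_bounds n a.
Qed.

Lemma steps_upto_le_max_steps (mu : nat -> fdist R A) n :
  (forall k, lifting step (mu k) (mu k.+1)) ->
  steps_upto mu n <= expect (mu 0%N) (max_steps n).
Proof.
elim: n mu => [|n IH] mu muS.
  by rewrite /steps_upto big_geq // expect_ge0 // => a; exact: max_steps_ge0.
rewrite /steps_upto big_nat_recl //= nf_probE.
have {}IH := IH (fun k => mu k.+1) (fun k => muS k.+1).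
apply: le_trans (lerD (lexx _) IH) _.
(* The first round charges 1 exactly to the reducible points; this charge is subtracted on the
   right. *)
have : expect (mu 1%N) (max_steps n) <=
    expect (mu 0%N) (fun b => max_steps n.+1 b + (-1) * reducible b).
  apply: lifting_expect_le (muS 0%N) => [b nf|b rho s].
    by rewrite !max_steps_nf // reducible_nf // mulr0 addr0.
  by rewrite (reducible_step s); have := max_steps_ge n s; lra.
by rewrite expect_addF expect_scaleF; lra.
Qed.

End Derivations.

(** * Redexes *)

(** The type of [args] depends on [f]; decidable equality of symbols allows projecting the equality
    of dependent pairs. *)
Lemma App_inj (S : signature) (V : Type) (f : S)
    (args args' : 'I_(arity f) -> term S V) :
  App f args = App f args' -> args = args'.
Proof. by case=> /(@eq_from_Tagged S (fun f => 'I_(arity f) -> term S V)). Qed.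

Lemma sum_nat_le1 n (F : 'I_n -> nat) i j :
  (\sum_(k < n) F k <= 1)%N -> (0 < F i)%N -> j != i -> F j = 0%N.
Proof.
move=> s1 Fi ji; move: s1; rewrite (bigD1 i) //= (bigD1 j) //=.
by case: (F i) Fi => // m _; case: (F j) => // p; rewrite addSn addnA addnS.
Qed.

Section Redexes.
Variables (S : signature) (V : countType).
Implicit Types (t u v : term S V) (s : V -> term S V).

(** * Substitutions and linear terms *)

Definition set_arg (f : S) (args : 'I_(arity f) -> term S V) (i : nat) u :
    term S V := App f (fun k => if (k : nat) == i then u else args k).

Definition set_var s x u : V -> term S V := fun y => if y == x then u else s y.

Lemma eq_subst s s' t :
  (forall x, vars t x -> s x = s' x) -> subst s t = subst s' t.
Proof.
elim: t => [x|f args IH] h /=; first by apply: h; rewrite /vars /= eqxx.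
congr App; apply/funext => i; apply: IH => x xi; apply: h.
by rewrite /vars /= (bigD1 i) //= ltn_addr.
Qed.

Lemma subst_inj s s' t :
  subst s t = subst s' t -> forall x, vars t x -> s x = s' x.
Proof.
elim: t => [x|f args IH] /= e y; rewrite /vars /=.
  by case: eqP => // ->.
rewrite lt0n sum_nat_eq0 => /forallPn[i]; rewrite -lt0n => yi.
exact: (IH i) (congr1 (fun h => h i) (App_inj e)) y yi.
Qed.

Lemma subst_subst W X (s1 : V -> term S W) (s2 : W -> term S X) t :
  subst s2 (subst s1 t) = subst (subst s2 \o s1) t.
Proof. by elim: t => //= f args IH; congr App; apply/funext => i; exact: IH. Qed.

Lemma subst_set_var_notin s x u t :
  nocc x t = 0%N -> subst (set_var s x u) t = subst s t.
Proof.
move=> xt; apply: eq_subst => y; rewrite /vars /= /set_var.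
by case: eqP => // ->; rewrite xt.
Qed.

(** By linearity [x] occurs in no other argument, so changing its value affects argument [i]
    alone. *)
Lemma subst_set_var_arg s x u f (args : 'I_(arity f) -> term S V) i :
  linear_term (App f args) -> vars (args i) x ->
  subst (set_var s x u) (App f args) =
  set_arg (fun k => subst s (args k)) i (subst (set_var s x u) (args i)).
Proof.
move=> lin xi; congr App; apply/funext => k; case: eqP => [/val_inj -> //|ki].
apply: subst_set_var_notin; apply: sum_nat_le1 (lin x) xi _.
by apply/eqP => e; apply: ki; rewrite e.
Qed.

Lemma linear_arg f (args : 'I_(arity f) -> term S V) i :
  linear_term (App f args) -> linear_term (args i).
Proof.
by move=> lin x; apply: leq_trans (lin x); rewrite /= (bigD1 i) //= leq_addr.
Qed.

(** * Redexes and the steps they induce *)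

Variables (R : realType) (P : ptrs R S V).
Implicit Types (r : rule R S V) (g : term S V -> term S V).

Definition root_redex (inner : bool) u r g : Prop :=
  exists s, [/\ rules P r, u = subst s (lhs r), g = subst s &
    inner -> forall w, proper_subterm w u -> normal_form (full_step P) w].

(* [redex inner u r g]: the rule [r] applies somewhere in [u], innermost if
   [inner] is set, and the step replaces [u] by [g t] with [t] drawn from
   [rhs r]. *)
Fixpoint redex (inner : bool) u r g : Prop :=
  root_redex inner u r g \/
  match u with
  | Var _ => False
  | App f args => exists i g', redex inner (args i) r g' /\
      g = fun t => set_arg args i (g' t)
  end.

Lemma redex_arg inner (f : S) (args : 'I_(arity f) -> term S V) i r g :
  redex inner (args i) r g ->
  redex inner (App f args) r (fun t => set_arg args i (g t)).
Proof. by move=> h; right; exists i, g. Qed.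

Lemma redex_set_arg inner (f : S) (args : 'I_(arity f) -> term S V)
    (i : 'I_(arity f)) u r g :
  redex inner u r g ->
  redex inner (set_arg args i u) r (fun t => set_arg args i (g t)).
Proof.
move=> h; right; exists i, g; rewrite eqxx; split => //.
by apply/funext => t; congr App; apply/funext => k; case: eqP.
Qed.

Lemma set_argC (f : S) (args : 'I_(arity f) -> term S V)
    (i j : 'I_(arity f)) t u :
  i != j ->
  set_arg (fun k => if (k : nat) == i then t else args k) j u =
  set_arg (fun k => if (k : nat) == j then u else args k) i t.
Proof.
move=> ij; congr App; apply/funext => k.
case: eqP => [kj|//]; case: eqP => // ki; case/eqP: ij.
by apply: val_inj; rewrite /= -ki -kj.
Qed.

Lemma redex_set_other inner (f : S) (args : 'I_(arity f) -> term S V)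
    (i j : 'I_(arity f)) u r g :
  i != j ->
  redex inner (args i) r g ->
  redex inner (set_arg args j u) r
    (fun t => set_arg (fun k => if (k : nat) == j then u else args k) i (g t)).
Proof.
move=> ij h; right; exists i, g; split => //.
by case: eqP => // /val_inj e; rewrite e eqxx in ij.
Qed.

Lemma redex_inner inner u r g : redex true u r g -> redex inner u r g.
Proof.
elim: u g => [x|f args IH] g /= [[s [Pr e ge h]]|].
- by left; exists s; split => // _; exact: h.
- by [].
- by left; exists s; split => // _; exact: h.
- by case=> i [g' [/IH h ->]]; right; exists i, g'.
Qed.

(** With [redex_position], this links the recursive notion of redex, suited to induction on terms,
    to contraction at a position. *)
Lemma redex_root_at (inner : bool) u r s pi :
  rules P r -> subterm_at u pi = Some (subst s (lhs r)) ->
  (inner -> forall w, proper_subterm w (subst s (lhs r)) ->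
    normal_form (full_step P) w) ->
  redex inner u r (fun t => replace_at u pi (subst s t)).
Proof.
move=> Pr + inn; elim: pi u => [|i pi IH] [x|f args] //=.
- by case=> e; left; exists s; split; rewrite // e.
- by case=> e; left; exists s; split; rewrite // e.
case: insubP => // j _ ji /IH h.
right; exists j, (fun t => replace_at (args j) pi (subst s t)); split => //.
apply/funext => t; congr App; apply/funext => k; rewrite ji.
by case: eqP => // ki; have -> : k = j by apply: val_inj; rewrite /= ki ji.
Qed.

Lemma redex_position inner u r g : redex inner u r g ->
  exists pi s, [/\ rules P r, subterm_at u pi = Some (subst s (lhs r)),
    g = (fun t => replace_at u pi (subst s t)) &
    inner -> forall w, proper_subterm w (subst s (lhs r)) ->
      normal_form (full_step P) w].
Proof.
elim: u g => [x|f args IH] g /= [[s [Pr e -> h]]|//].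
- by exists [::], s; rewrite -e; split.
- by exists [::], s; rewrite -e; split.
- move=> [i [g' [/IH[pi [s [Pr e -> h]]] ->]]].
  exists (val i :: pi), s; split => //=; first by rewrite valK.
  apply/funext => t; congr App; apply/funext => k.
  by case: eqP => // /val_inj ->.
Qed.

Definition step_dist (r : rule R S V) g : fdist R (term S V) :=
  FDist (is_fdist_map g (rhs r)).

Lemma full_stepP u mu :
  full_step P u mu <-> exists r g, redex false u r g /\ mu = step_dist r g.
Proof.
split=> [[pi [r [s [Pr [e mE]]]]]|[r [g [/redex_position[pi [s [Pr e gE _]]] ->]]]].
  exists r, (fun t => replace_at u pi (subst s t)).
  by split; [exact: redex_root_at|exact: fdist_inj].
by exists pi, r, s; split => //; split => //; rewrite gE.
Qed.

Lemma innermost_stepP u mu :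
  innermost_step P u mu <-> exists r g, redex true u r g /\ mu = step_dist r g.
Proof.
split=> [[pi [r [s [Pr [e mE] h]]]]|[r [g [/redex_position[pi [s [Pr e gE h]]] ->]]]].
  exists r, (fun t => replace_at u pi (subst s t)).
  by split; [exact: redex_root_at|exact: fdist_inj].
by exists pi, r, s; split => //; [split => //; rewrite gE|exact: h].
Qed.

Lemma innermost_full u mu : innermost_step P u mu -> full_step P u mu.
Proof.
move=> /innermost_stepP[r [g [h ->]]]; apply/full_stepP.
by exists r, g; split => //; exact: redex_inner.
Qed.

Lemma redex_subterm inner u pi w r g : subterm_at u pi = Some w ->
  redex inner w r g -> exists g', redex inner u r g'.
Proof.
elim: pi u => [|i pi IH] [x|f args] //=.
- by case=> <-; exists g.
- by case=> <-; exists g.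
case: insubP => // j _ _ e h; have [g' h'] := IH _ e h.
by exists (fun t => set_arg args j (g' t)); right; exists j, g'.
Qed.

(** * Normal forms of full and innermost rewriting *)

Lemma normal_form_redex u :
  (forall r g, ~ redex false u r g) -> normal_form (full_step P) u.
Proof. by move=> h [mu /full_stepP[r [g [/h]]]]. Qed.

(** Descend into an argument that contains a redex as long as there is one; once there is none, the
    root redex is innermost. *)
Lemma redex_innermost_exists u r g :
  redex false u r g -> exists r' g', redex true u r' g'.
Proof.
elim: u r g => [x|f args IH] r g.
  case=> // -[s [Pr + _ _]]; have := rules_lhs Pr.
  by case: (lhs r).
have [[i [r' [g' h]]] _|noarg] :=
    pselect (exists i r g, redex false (args i) r g).
  have [r1 [g1 h1]] := IH _ _ _ h.
  by exists r1, (fun t => set_arg args i (g1 t)); exact: redex_arg.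
case=> [[s [Pr e _ _]]|[i [g' [h _]]]]; last by case: noarg; exists i, r, g'.
exists r, (subst s); left; exists s; split => // _ w [[|i pi] //= _].
case: insubP => // j _ _ wj; apply: normal_form_redex => r1 g1 h1.
by have [g2 h2] := redex_subterm wj h1; apply: noarg; exists j, r1, g2.
Qed.

Lemma normal_form_innermost u :
  normal_form (innermost_step P) u <-> normal_form (full_step P) u.
Proof.
split=> nf [mu h]; apply: nf; last by exists mu; exact: innermost_full.
have /full_stepP[r [g [/redex_innermost_exists[r' [g' h']] _]]] := h.
by exists (step_dist r' g'); apply/innermost_stepP; exists r', g'.
Qed.

(** * Redexes in instances of linear terms *)

Lemma redex_subst inner s x r g t : redex inner (s x) r g ->
  linear_term t -> vars t x ->
  redex inner (subst s t) r (fun t' => subst (set_var s x (g t')) t).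
Proof.
move=> h; elim: t => [y|f args IH] lin; rewrite /vars /=.
  by case: eqP => // <- _; rewrite /set_var eqxx; exact: h.
rewrite lt0n sum_nat_eq0 => /forallPn[i]; rewrite -lt0n => xi.
right; exists i, (fun t' => subst (set_var s x (g t')) (args i)); split.
  by apply: IH => //; exact: linear_arg lin.
by apply/funext => t'; rewrite -(subst_set_var_arg _ _ lin xi).
Qed.

(** The redex lies at the root, at a non-variable position of [v] below the root, or inside the
    substitution. The middle case does not track [g], as it only serves to produce an overlap. *)
Lemma redex_substP inner s v r g : linear_term v -> redex inner (subst s v) r g ->
  [\/ ~~ is_var v /\ root_redex inner (subst s v) r g,
      exists pi w s', [/\ pi <> [::], subterm_at v pi = Some w, ~~ is_var w,
        rules P r & subst s w = subst s' (lhs r)] |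
      exists x g', [/\ vars v x, redex inner (s x) r g' &
        g = fun t => subst (set_var s x (g' t)) v]].
Proof.
elim: v g => [x|f args IH] g lin.
  (* At a variable even a redex at the root lies inside the substitution. *)
  move=> h; apply: Or33; exists x, g; split => //; first by rewrite /vars /= eqxx.
  by apply/funext => t /=; rewrite /set_var eqxx.
case=> [h|[i [g' [/(IH i _ (linear_arg i lin)) + ->]]]]; first exact: Or31.
move=> [[vi [s' [Pr e _ _]]]|[pi [w [s' [_ vw nw Pr e]]]]|[x [g'' [xi h ->]]]].
- by apply: Or32; exists [:: val i], (args i), s'; split => //=;
  rewrite valK; case: (args i).
- by apply: Or32; exists (val i :: pi), w, s'; split => //=; rewrite valK.
- apply: Or33; exists x, g''; split => //.
    by rewrite /vars /= (bigD1 i) //= ltn_addr.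
  by apply/funext => t; rewrite (subst_set_var_arg _ _ lin xi).
Qed.

Lemma overlap_instance r r' pi u s s' :
  subterm_at (lhs r) pi = Some u -> ~~ is_var u -> (r = r' -> pi <> [::]) ->
  subst s u = subst s' (lhs r') -> overlap r r' pi.
Proof.
move=> upi nu rpi e; exists u; split => //.
(* A unifier must map into terms over [V + V], so the common instance over [V] is embedded by
   [inl]. *)
exists (fun z => rename inl (match z with inl x => s x | inr x => s' x end)).
rewrite /rename !subst_subst.
have H (k : V -> V + V) (q : V -> term S V) t :
    (forall x, match k x with inl y => s y | inr y => s' y end = q x) ->
    subst (subst (fun z : V + V => subst (fun x => Var (inl x : V + V))
      (match z with inl x => s x | inr x => s' x end)) \o (fun x => Var (k x))) t =
    subst (fun x => Var (inl x)) (subst q t).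
  move=> kq; rewrite subst_subst; congr subst; apply/funext => x /=.
  by rewrite kq.
by rewrite (H _ s) // (H _ s') // e.
Qed.

(** * Joining a full step with an innermost step *)

Hypotheses (orthoP : orthogonal_ptrs P) (rlinP : right_linear P).

(* The two steps coincide, or they can be joined: the pair [t, t'] of outcomes
   leads to [h t t'] in both orders, except that the step [g] may have erased
   the innermost redex. *)
Definition joinable r g r' g' : Prop :=
  (r = r' /\ forall t, fdist_supp (rhs r) t -> g t = g' t) \/
  exists h : term S V -> term S V -> term S V,
    (forall t', redex false (g' t') r (h^~ t')) /\
    (forall t, fdist_supp (rhs r) t ->
      redex true (g t) r' (h t) \/ forall t', h t t' = g t).

(** Non-overlap leaves two cases: the same rule at the root, whose matcher is determined on the
    variables of the right-hand sides, or a redex inside the value of one variable [x]. *)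
Lemma joinable_root r s r' g' : rules P r ->
  redex true (subst s (lhs r)) r' g' -> joinable r (subst s) r' g'.
Proof.
have [nonov llin] := orthoP => Pr.
move=> /(redex_substP (llin _ Pr))[[nv [s' [Pr' e -> _]]]||].
- have [rr'|nrr'] := pselect (r = r'); last first.
    case: (nonov r r' [::] Pr Pr').
    by apply: (overlap_instance _ nv _ e) => //; case: (lhs r).
  left; split => // t tr; rewrite -rr' in e.
  apply: eq_subst => x /(rules_vars Pr tr); exact: subst_inj e x.
- move=> [pi [w [s' [npi wpi nw Pr' e]]]].
  by case: (nonov r r' pi Pr Pr'); exact: overlap_instance e.
- move=> [x [g'' [xl h ->]]]; right.
  exists (fun t t' => subst (set_var s x (g'' t')) t); split => [t'|t tr].
    suff : root_redex false (subst (set_var s x (g'' t')) (lhs r)) r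
        (subst (set_var s x (g'' t'))) by case: (subst _ (lhs r)) => *; left.
    by exists (set_var s x (g'' t')).
  have [xt|xt] := pselect (vars t x).
    by left; apply: redex_subst => //; exact: rlinP tr.
  right=> t'; apply: subst_set_var_notin; apply/eqP.
  by rewrite -leqn0 leqNgt; apply/negP.
Qed.

Lemma redex_joinable u r g r' g' :
  redex false u r g -> redex true u r' g' -> joinable r g r' g'.
Proof.
elim: u g g' => [x|f args IH] g g'.
  by case=> // -[s [Pr -> -> _]]; exact: joinable_root.
case=> [[s [Pr e -> _]]|[i [g1 [h1 ->]]]].
  by rewrite e; exact: joinable_root.
(* An innermost redex at the root would contradict the redex in argument [i]. *)
case=> [[s' [_ _ _ inn]]|[j [g1' [h1' ->]]]].
  have /(inn isT)[] : proper_subterm (args i) (App f args).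
    by exists [:: val i] => //=; rewrite valK; case: (args i).
  by exists (step_dist r g1); apply/full_stepP; exists r, g1.
have [ij|ij] := eqVneq i j.
  case: _ / ij h1' => h1'.
  case: (IH _ _ _ h1 h1') => [[-> gg']|[h [hl hr]]].
    by left; split => // t tr; rewrite gg'.
  right; exists (fun t t' => set_arg args i (h t t')).
  split=> [t'|t /hr[rt|ht]].
  - exact: redex_set_arg (hl t').
  - by left; exact: redex_set_arg rt.
  - by right=> t'; rewrite ht.
(* Redexes in distinct arguments are parallel, so the two contractions commute. *)
right; exists (fun t t' =>
  set_arg (fun k => if (k : nat) == i then g1 t else args k) j (g1' t')).
split=> [t'|t _].
  under eq_fun do rewrite set_argC //.
  exact: redex_set_other.
by left; apply: redex_set_other; rewrite // eq_sym.
Qed.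

End Redexes.

(** * Innermost steps do not lose expected length *)

Section Linear.
Variables (R : realType) (S : signature) (V : countType) (P : ptrs R S V).
Hypotheses (orthoP : orthogonal_ptrs P) (rlinP : right_linear P).
Let full := full_step P.
Let inner := innermost_step P.

(** Take any full first step. If it differs from the innermost one, the innermost step is moved in
    front of it by joinability, the induction hypothesis bounding the remaining [n] rounds. *)
Lemma max_steps_innermost n u nu : inner u nu ->
  max_steps full n u <= 1 + expect nu (max_steps full n).
Proof.
elim: n u nu => [|n IH] u nu hnu.
  by rewrite addr_ge0 // expect_ge0 // => a; exact: max_steps_ge0.
apply: max_stepsS_le => [|mu].
  by rewrite addr_ge0 // expect_ge0 // => a; exact: max_steps_ge0.
move=> /full_stepP[r [g [rg ->]]].
move: hnu => /innermost_stepP[r' [g' [rg' ->]]]; rewrite lerD2l !expect_map.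
case: (redex_joinable orthoP rlinP rg rg') => [[<- gg']|[h [hl hr]]].
  by apply: le_expect => t /gg' /= ->; exact: max_steps_mono.
have le1 t : fdist_supp (rhs r) t -> max_steps full n (g t) <=
    1 + expect (rhs r') (fun t' => max_steps full n (h t t')).
  move=> /hr[rt|ht].
    have := IH (g t) (step_dist r' (h t)).
    by rewrite expect_map; apply; apply/innermost_stepP; exists r', (h t).
  (* If the innermost redex was erased, the outcome no longer depends on [t'] and the extra 1 is
     slack. *)
  under [X in expect _ X]eq_fun do rewrite ht.
  by rewrite expect_cst lerDr.
apply: le_trans (le_expect le1) _.
rewrite expect_addF expect_cst expect_exchange.
(* The 1 moves under the expectation over [t'], where it pays for the full step from [g' t']. *)
rewrite -[X in X + _](expect_cst (rhs r') 1) -expect_addF.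
apply: le_expect => t' _ /=.
have := @max_steps_ge _ _ full n (g' t') (step_dist r (h^~ t')).
by rewrite expect_map; apply; apply/full_stepP; exists r, (h^~ t').
Qed.

Lemma nf_prob_innermost mu : nf_prob inner mu = nf_prob full mu.
Proof.
by apply: eq_bigl => x; apply/asboolP/asboolP => /normal_form_innermost.
Qed.

Lemma lifting_innermost_full mu nu : lifting inner mu nu -> lifting full mu nu.
Proof.
elim=> {mu nu} [t /normal_form_innermost nf|t mu s|k p mu nu mu' nu' p0 p1 _ IH e e'].
- exact: lifting_nf.
- exact: lifting_step (innermost_full s).
- exact: lifting_mix p0 p1 IH e e'.
Qed.

Lemma max_steps_le_innermost (nu : nat -> fdist R (term S V)) n N :
  (forall k, lifting inner (nu k) (nu k.+1)) ->
  expect (nu 0%N) (max_steps full n) <=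
  steps_upto inner nu N + n%:R * (1 - nf_prob inner (nu N)).
Proof.
move=> nuS; apply: (@le_trans _ _
    (steps_upto inner nu N + expect (nu N) (max_steps full n))); last first.
  rewrite lerD2l nf_prob_innermost nf_probE -expect_scaleF.
  by apply: le_expect => t _; exact: max_steps_le_reducible.
elim: N => [|N IH]; first by rewrite /steps_upto big_geq // add0r.
apply: le_trans IH _; rewrite /steps_upto big_nat_recr //= -addrA lerD2l.
rewrite nf_prob_innermost nf_probE -lerBlDl.
(* Negation turns the upper bound of [lifting_expect_le] into the lower bound needed for the later
   expectation. *)
have : expect (nu N.+1) (fun t => (-1) * max_steps full n t) <=
    expect (nu N) (fun t => reducible full t + (-1) * max_steps full n t).
  apply: lifting_expect_le (nuS N) => [t /normal_form_innermost nf|t rho s].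
    by rewrite !max_steps_nf // reducible_nf // mulr0 addr0.
  rewrite expect_scaleF (reducible_step (innermost_full s)).
  by have := max_steps_innermost n s; lra.
by rewrite expect_addF !expect_scaleF; lra.
Qed.

Lemma max_steps_le_edl (nu : nat -> fdist R (term S V)) n :
  (forall k, lifting inner (nu k) (nu k.+1)) ->
  ((expect (nu 0%N) (max_steps full n))%:E <= edl inner nu)%E.
Proof.
move=> nuS.
have bound N := steps_upto_le_edl inner nu N.
case: (edl inner nu) bound => [E bound|bound|bound]; last 2 first.
- exact: leey.
- by have := bound 0%N.
rewrite lee_fin leNgt; apply/negP => lt.
set x := expect _ _ in lt.
have {}bound N : steps_upto inner nu N <= E by rewrite -lee_fin.
(* Otherwise the expected number of steps in each round is bounded below. *)
have alive N : x - E <= n%:R * (1 - nf_prob inner (nu N)).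
  by have := max_steps_le_innermost n N nuS; have := bound N; rewrite -/x; lra.
have grow N : N%:R * (x - E) <= n%:R * steps_upto inner nu N.
  elim: N => [|N IH]; first by rewrite /steps_upto big_geq // mul0r mulr0.
  rewrite /steps_upto big_nat_recr //= -natr1 mulrDl mul1r [n%:R * _]mulrDr.
  exact: lerD IH (alive N).
have xE : 0 < x - E by rewrite subr_gt0.
(* Archimedean choice: after [N] rounds [N * (x - E)] exceeds [n * E], against [grow] and
   [bound]. *)
pose N := Num.bound (n%:R * E / (x - E)).
have nE : 0 <= n%:R * E / (x - E).
  apply: divr_ge0; last exact: ltW.
  by apply: mulr_ge0 => //; have := bound 0%N; rewrite /steps_upto big_geq.
have := archi_boundP nE; rewrite -/N ltr_pdivrMr // => /lt_le_trans/(_ (grow N)).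
by rewrite ltNge ler_wpM2l.
Qed.

(** Any single innermost sequence dominates every full one. Conversely, an innermost sequence is
    also a full one, of the same length because the normal forms agree. *)
Lemma edh_full_innermost t : edh full t = edh inner t.
Proof.
apply/eqP; rewrite eq_le; apply/andP; split; apply: ge_ereal_sup.
  move=> _ [->|[mu [mu0 muS] <-]]; first by apply: ereal_sup_ubound; left.
  have [nu [nu0 nuS]] := lifting_sequence inner t.
  apply: (@le_trans _ _ (edl inner nu)); last first.
    by apply: ereal_sup_ubound; right; exists nu.
  apply: edl_le => n; apply: le_trans (max_steps_le_edl n nuS).
  by rewrite lee_fin nu0 -mu0; exact: steps_upto_le_max_steps.
move=> _ [->|[nu [nu0 nuS] <-]]; first by apply: ereal_sup_ubound; left.
apply: ereal_sup_ubound; right; exists nu.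
  by split => // n; exact: lifting_innermost_full.
by congr (limn _); apply/funext => n; apply: eq_bigr => i _; rewrite nf_prob_innermost.
Qed.

End Linear.

Theorem theorem4p6 (R : realType) (S : signature) (V : countType) (P : ptrs R S V)
    (orthoP : orthogonal_ptrs P) (rlinP : right_linear P) :
  edc (full_step P) = edc (innermost_step P) /\
  erc P (full_step P) = erc P (innermost_step P).
Proof.
have e : edh (full_step P) = edh (innermost_step P).
  by apply/funext => t; exact: edh_full_innermost.
by rewrite /edc /erc e.
Qed.
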